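(* Let $G$ be a simple graph of order $n$ and let $\Delta$ be a non-negative integer. Then $G$ is (isomorphic to) a $\Delta$-regular graph if and only if $[x]\,da(G;x,y)=n\,y^{n-\Delta}$.
   Context: All graphs are finite, simple and have at least one vertex. For a graph $G$, $S\subseteq V(G)$ and $u\in V(G)$, let $\bar S=V(G)\setminus S$, let $\delta_S(u)=|\{v\in S:\{u,v\}\in E(G)\}|$, and let $G[S]$ be the subgraph induced by $S$. The defensive alliance polynomial of $G$ is $$da(G;x,y)=\sum_{S} x^{|S|}\,y^{f_y(S)},\qquad f_y(S)=\min_{u\in S}\bigl(\delta_S(u)-\delta_{\bar S}(u)+|V(G)|\bigr),$$ where the sum runs over all non-empty $S\subseteq V(G)$ such that $G[S]$ is connected (single-vertex graphs are connected). $[x^k]\,da(G;x,y)$ denotes the coefficient of $x^k$ in $da(G;x,y)$, which is a polynomial in $y$. *)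

(* Defs.v *)
From mathcomp Require Import all_boot all_order all_algebra.

Set Implicit Arguments.
Unset Strict Implicit.
Unset Printing Implicit Defensive.

Import GRing.Theory.
Local Open Scope ring_scope.

Record sgraph := SGraph {
  vertex :> finType;
  edge : rel vertex;
  edge_sym : symmetric edge;
  edge_irrefl : irreflexive edge
}.

Section Graph.
Variable G : sgraph.
Implicit Types (S : {set G}) (u : G).

Definition induced S : sgraph :=
  @SGraph {v : G | v \in S} (fun v w => edge (val v) (val w))
    (fun v w => edge_sym (val v) (val w)) (fun v => edge_irrefl (val v)).

Definition connected : bool := [forall v : G, forall w : G, connect (@edge G) v w].

Definition degree u : nat := #|[set v : G | edge u v]|.

Definition regular (Delta : nat) : Prop := forall u : G, degree u = Delta.

Definition delta S u : nat := #|[set v in S | edge u v]|.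

(* [delta (~: S) u <= #|G|], so the natural number subtraction never
   truncates. *)
Definition fy_at S u : nat := (delta S u + #|G| - delta (~: S) u)%N.

(* Minimum over [u \in S]. Since [fy_at S u <= 2 * #|G|] for every [u], the
   default value does not affect the minimum when [S] is nonempty. *)
Definition fy S : nat := \big[minn/(2 * #|G|)%N]_(u in S) fy_at S u.

End Graph.

(* The polynomial ring in x and y is encoded as [{poly {poly int}}]: the outer
   variable is x and the inner one is y, so that the coefficient of x^k is
   [(da G)`_k : {poly int}], a polynomial in y. Nonemptiness of [S] is required
   separately because [connected] holds vacuously on the empty vertex set. *)
Definition da (G : sgraph) : {poly {poly int}} :=
  \sum_(S : {set G} | (S != set0) && connected (induced S))
     'X^#|S| * ('X^(fy S))%:P.

(* Main.v *)
Require Import Defs.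
From mathcomp Require Import all_boot all_order all_algebra.

Set Implicit Arguments.
Unset Strict Implicit.
Unset Printing Implicit Defensive.

Import GRing.Theory.
Local Open Scope ring_scope.

(** Only singletons contribute to $[x]\,da$, and $\{u\}$ contributes $y^{n-\deg u}$ ([fy_set1],
    [coef1_da]). Regularity makes these $n$ monomials equal; conversely, the coefficient of
    $y^{n-\Delta}$ forces all $n$ of them to have that exponent. *)

Lemma degree_lt (G : sgraph) (u : G) : (degree u < #|G|)%N.
Proof.
rewrite /degree -cardsT; apply: proper_card; apply/properP; split.
  exact: subsetT.
by exists u; rewrite ?inE // edge_irrefl.
Qed.

Lemma connected_set1 (G : sgraph) (u : G) : connected (induced [set u]).
Proof.
apply/forallP => v; apply/forallP => w.
suff -> : v = w by exact: connect0.
by apply/val_inj; rewrite (set1P (valP v)) (set1P (valP w)).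
Qed.

(** As there are no loops, every neighbour of [u] lies outside [[set u]]. *)
Lemma fy_set1 (G : sgraph) (u : G) : fy [set u] = (#|G| - degree u)%N.
Proof.
have fyE : fy_at [set u] u = (#|G| - degree u)%N.
  rewrite /fy_at /delta.
  have -> : [set v in [set u] | edge u v] = set0.
    apply/setP => v; rewrite !inE.
    by case: eqP => // ->; rewrite edge_irrefl.
  rewrite cards0 add0n /degree; congr (_ - #|pred_of_set _|)%N.
  apply/setP => v; rewrite !inE.
  by case: eqP => // ->; rewrite edge_irrefl.
(* The default [2 * #|G|] is not neutral for [minn], so it stays as an operand and must be bounded
   below. *)
rewrite /fy big_set1E /= fyE; apply/minn_idPl.
by rewrite (leq_trans (leq_subr _ _)) // leq_pmull.
Qed.

Lemma coef1_da (G : sgraph) : (da G)`_1 = \sum_(u : G) 'X^(#|G| - degree u).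
Proof.
rewrite /da coef_sum.
under eq_bigr => S _ do rewrite coefMC coefXn eq_sym mulr_natl mulrb.
rewrite -big_mkcondr /=.
(* Singletons are nonempty and connected, so the condition [#|S| == 1] alone selects the terms. *)
transitivity (\sum_(S in [set [set u] | u : G]) 'X^(fy S) : {poly int}).
  apply: eq_bigl => S; apply/idP/imsetP => [/andP[_ /cards1P[u ->]]|[u _ ->]].
    by exists u.
  by rewrite cards1 eqxx connected_set1 -card_gt0 cards1.
rewrite big_imset /=; last by move=> u v _ _; exact: set1_inj.
by apply: eq_bigr => u _; rewrite fy_set1.
Qed.

Theorem proposition21 (G : sgraph) (n Delta : nat)
    (n_gt0 : (0 < n)%N) (order_G : #|G| = n) :
  regular G Delta <-> (da G)`_1 = n%:R * 'X^(n - Delta) :> {poly int}.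
Proof.
rewrite coef1_da order_G; split=> [regG | sumE u].
  under eq_bigr => u _ do rewrite regG.
  by rewrite sumr_const order_G mulr_natl.
have deg_lt : (degree u < n)%N by rewrite -order_G degree_lt.
(* Comparing coefficients of y^(n - Delta) counts the vertices v with
   n - degree v = n - Delta. *)
have := congr1 (fun p : {poly int} => p`_(n - Delta)) sumE.
rewrite coef_sum mulr_natl coefMn coefXn eqxx.
under eq_bigr => v _ do rewrite coefXn.
rewrite -natr_sum => /eqP; rewrite Num.Theory.eqr_nat -big_mkcond /= sum1_card.
(* The counted set has as many elements as [G], so it contains [u]. *)
rewrite -order_G => /eqP /subset_cardP/(_ (subset_predT _))/(_ u).
rewrite !inE order_G => /eqP subE.
(* [degree u < n] rules out that both subtractions truncate to 0. *)
have deg_gt : (0 < n - Delta)%N by rewrite subE subn_gt0.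
by apply/eqP; rewrite -(eqn_sub2lE (ltnW deg_lt)) ?subE // ltnW // -subn_gt0.
Qed.
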